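(* Let $n\ge1$, $m>0$, let $a(\cdot)>0$ be the scale-function on $[0,T_1)$, let $u=u(t,x')$ be a complex-valued function for which the expectation values below are finite, and let $U(x'):=\frac m2U_*\big(\sum_{k=1}^n\langle x^k\rangle\langle x_k\rangle\big)\sum_{k=1}^nx^kx_k$ for a real-valued function $U_*$. Put $X^j:=\langle x^j\rangle$, $X_j:=\langle x_j\rangle=a^2X^j$, $r:=\big(\sum_{j=1}^nX^jX_j\big)^{1/2}$, $Y^j(t):=a(t)X^j(t)$, $|Y|:=\{\sum_{j=1}^n(Y^j)^2\}^{1/2}$, and $A:=-\frac14\left(\frac{D_ta^2}{a^2}\right)^2-\frac12D_t\left(\frac{D_ta^2}{a^2}\right)$. Then for $1\le j\le n$: (1) $\langle\partial^jU\rangle=m\,U_*(r^2)X^j$. (2) The equation $$mD_t^2\langle x^j\rangle(t)+m\frac{D_ta^2(t)}{a^2(t)}D_t\langle x^j\rangle(t)+\langle\partial^jU\rangle(t)=0$$ is rewritten (equivalently) as $$D_t^2X^j+\frac{D_ta^2}{a^2}D_tX^j+U_*(r^2)X^j=0.$$ (3) The equation $D_t^2X^j+\frac{D_ta^2}{a^2}D_tX^j+U_*(r^2)X^j=0$ is rewritten (equivalently) as $$D_t^2Y^j+AY^j+U_*(|Y|^2)Y^j=0.$$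
   Context: $D_t:=d/dt$, $x'=(x^1,\dots,x^n)\in\mathbb{R}^n$, $\partial_j=\partial/\partial x^j$. For $a_0>0$, $a_1,\sigma\in\mathbb{R}$: if $\sigma\ne-1$ and $a_1\ne0$ put $T_0:=-\frac{2a_0}{n(1+\sigma)a_1}$; $T_1:=T_0$ if $(1+\sigma)a_1<0$ and $T_1:=\infty$ otherwise. For $0\le t<T_1$, $a(t):=a_0\left(1+\frac{n(1+\sigma)a_1t}{2a_0}\right)^{2/(n(1+\sigma))}$ if $\sigma\ne-1$, and $a(t):=a_0e^{a_1t/a_0}$ if $\sigma=-1$; $a^2(t)=a(t)^2$. Indices are lowered and raised with the metric $\mathrm{diag}(a^2,\dots,a^2)$: $x_j:=a^2x^j$, $\partial^j:=a^{-2}\partial_j$ (so $U$ depends on $t$ through $a$ and through the expectation values, which are constants for $\partial_j$). Expectation values: $\langle h\rangle(t):=\int_{\mathbb{R}^n}\overline{u(t,x')}\,h\,u(t,x')\,dx'$ for $h=x^j,\ x_j$ or any function $h$; in the paper $u$ is a solution of the Schr\''odinger equation $i\frac{2m}{\hbar}\partial_tu+\frac1{a^2}\Delta u-\frac{2m}{\hbar^2}Uu=0$. The functions $X^j$ are assumed twice differentiable in $t$ in (2) and (3). *)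

(* Defs.v *)
From HB Require Import structures.
From mathcomp Require Import all_boot all_order all_algebra complex.
From mathcomp Require Import all_classical all_reals all_analysis.

Set Implicit Arguments.
Unset Strict Implicit.
Unset Printing Implicit Defensive.

Import Order.TTheory GRing.Theory Num.Theory.
Import numFieldNormedType.Exports.

Local Open Scope classical_set_scope.
Local Open Scope ring_scope.

Section LebesgueMeasureOnRn.
Variable R : realType.

Definition tuple_of_pair n (z : R * n.-tuple R) : n.+1.-tuple R :=
  [tuple of z.1 :: z.2].

Lemma measurable_tuple_of_pair n : measurable_fun setT (@tuple_of_pair n).
Proof. exact: measurable_cons. Qed.

Definition lebesgue_cons n (mu : {measure set (n.-tuple R) -> \bar R}) :
    set (n.+1.-tuple R) -> \bar R :=
  pushforward (lebesgue_measure \x^ mu)%E (@tuple_of_pair n).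

HB.instance Definition _ n (mu : {measure set (n.-tuple R) -> \bar R}) :=
  Measure.copy (lebesgue_cons mu)
    (measure_function_pushforward__canonical__measure_function_Measure
       (lebesgue_measure \x^ mu)%E (@measurable_tuple_of_pair n)).

(* n-dimensional Lebesgue measure, carried by tuples because these, unlike row
   vectors, have a product sigma-algebra in the library. *)
Fixpoint lebesgue_tuple n : {measure set (n.-tuple R) -> \bar R} :=
  match n with
  | 0 => \d_([tuple] : 0.-tuple R)
  | n'.+1 => lebesgue_cons (lebesgue_tuple n')
  end.

Lemma lebesgue_tuple_box n (A : 'I_n -> set R) :
  (forall i, measurable (A i)) ->
  lebesgue_tuple n [set x | forall i, A i (tnth x i)]
  = (\prod_(i < n) lebesgue_measure (A i))%E.
Proof.
elim: n A => [|n IH] A mA.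
  by rewrite big_ord0 /= diracE mem_set// => -[].
rewrite big_ord_recl -IH// -product_measure2E//.
  rewrite /= /lebesgue_cons /pushforward; congr (_ _).
  apply/seteqP; split=> [z/= H|z/= [H0 H] i].
    split; first by have := H ord0.
    by move=> i; have := H (lift ord0 i); rewrite tnthS.
  case: (unliftP ord0 i) => [j ->|->//].
  by rewrite tnthS; exact: H.
  exact: mA.
rewrite (_ : mkset _ =
    \bigcap_(i in [set: 'I_n]) (fun x : n.-tuple R => tnth x i) @^-1` (A (lift ord0 i))).
  apply: fin_bigcap_measurable => // i _; rewrite -[X in measurable X]setTI.
  exact: measurable_tnth.
by apply/seteqP; split => x /= H i; [move=> _|]; exact: H.
Qed.

End LebesgueMeasureOnRn.

Section ExpectationValues.
Variables (R : realType) (n : nat).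
Local Open Scope complex_scope.

(* Integration over R^n of functions of row vectors, against Lebesgue measure
   through the coordinate identification of tuples with row vectors. *)
Definition vec_of_tuple (x : n.-tuple R) : 'rV[R]_n := \row_k tnth x k.

Definition cintegrable (F : 'rV[R]_n -> R[i]) : Prop :=
  (lebesgue_tuple R n).-integrable setT
    (fun x => (complex.Re (F (vec_of_tuple x)))%:E) /\
  (lebesgue_tuple R n).-integrable setT
    (fun x => (complex.Im (F (vec_of_tuple x)))%:E).

Definition cintegral (F : 'rV[R]_n -> R[i]) : R[i] :=
  (\int[lebesgue_tuple R n]_x complex.Re (F (vec_of_tuple x))) +i*
  (\int[lebesgue_tuple R n]_x complex.Im (F (vec_of_tuple x))).

Definition expect_density (psi : 'rV[R]_n -> R[i]) (h : 'rV[R]_n -> R)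
    (x : 'rV[R]_n) : R[i] :=
  (psi x)^* * (h x)%:C * psi x.

Definition expect_finite (psi : 'rV[R]_n -> R[i]) (h : 'rV[R]_n -> R) : Prop :=
  cintegrable (expect_density psi h).

(* For a real-valued h the integral is real, see expectE; the real part only
   changes its type from R[i] to R. *)
Definition expect (psi : 'rV[R]_n -> R[i]) (h : 'rV[R]_n -> R) : R :=
  complex.Re (cintegral (expect_density psi h)).

Lemma expectE psi h : cintegral (expect_density psi h) = (expect psi h)%:C.
Proof.
rewrite /expect /cintegral /=; congr Complex.
rewrite (_ : (fun x => _) = cst 0).
  by rewrite /Rintegral /= integral0.
apply/funext => x; rewrite /expect_density; case: (psi _) => p q /=.
rewrite !mulr0 ?subr0 ?add0r !mulNr -[q * _ * p]mulrA [q * (_ * p)]mulrC.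
by rewrite [_ * p]mulrC subrr.
Qed.

End ExpectationValues.

Section ScaleFunction.
Variables (R : realType) (n : nat) (a0 a1 sigma : R).

Definition T0 : R := - (2 * a0) / (n%:R * (1 + sigma) * a1).

Definition T1 : \bar R :=
  if (1 + sigma) * a1 < 0 then T0%:E else +oo%E.

Definition time_interval : set R := [set t | 0 <= t /\ (t%:E < T1)%E].

Definition scale (t : R) : R :=
  if sigma == -1 then a0 * expR (a1 * t / a0)
  else a0 * (1 + n%:R * (1 + sigma) * a1 * t / (2 * a0))
              `^ (2 / (n%:R * (1 + sigma))).

End ScaleFunction.

(* d/dt for functions on an interval I : the difference quotient only involves
   times in I, so the derivative is one-sided at an endpoint belonging to I and
   values outside I are irrelevant. *)
Section TimeDerivative.
Variables (R : realType) (I : set R).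

Definition Dquot (f : R -> R) (t s : R) : R := (f s - f t) / (s - t).

Definition t_derivable (f : R -> R) : Prop :=
  forall t, I t -> cvg (Dquot f t s @[s --> within I t^']).

Definition Dt (f : R -> R) (t : R) : R :=
  lim (Dquot f t s @[s --> within I t^']).

Definition twice_t_derivable (f : R -> R) : Prop :=
  t_derivable f /\ t_derivable (Dt f).

End TimeDerivative.

Section Coordinates.
Variables (R : realType) (n : nat).

Definition coord_up (k : 'I_n) (x : 'rV[R]_n) : R := x 0 k.

Definition coord_low (a : R) (k : 'I_n) (x : 'rV[R]_n) : R := a ^+ 2 * x 0 k.

Definition partial_low (j : 'I_n) (f : 'rV[R]_n -> R) (x : 'rV[R]_n) : R :=
  'D_('e_j) f x.

Definition partial_up (a : R) (j : 'I_n) (f : 'rV[R]_n -> R) (x : 'rV[R]_n) : R :=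
  (a ^+ 2)^-1 * partial_low j f x.

(* a and psi are the values a(t) and u(t, .) at a fixed time *)
Definition potential (m : R) (Ustar : R -> R) (a : R) (psi : 'rV[R]_n -> R[i])
    (x : 'rV[R]_n) : R :=
  m / 2
  * Ustar (\sum_(k < n) expect psi (coord_up k) * expect psi (coord_low a k))
  * \sum_(k < n) coord_up k x * coord_low a k x.

End Coordinates.

(* Main.v *)
Require Import Defs.
From mathcomp Require Import all_boot all_order all_algebra complex.
From mathcomp Require Import all_classical all_reals all_analysis.
From mathcomp Require Import ring lra.

Set Implicit Arguments.
Unset Strict Implicit.
Unset Printing Implicit Defensive.

Import Order.TTheory GRing.Theory Num.Theory.
Import numFieldNormedType.Exports.

Local Open Scope classical_set_scope.
Local Open Scope ring_scope.

(** Fix a time t and put K = Ustar (sum_k <x^k><x_k>).  The potential is the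
    quadratic form x |-> m/2 K a^2 |x|^2, so its raised partial derivative is
    m K x^j, and (1) is the linearity of the expectation
    ([expect_partial_up_potential]).  Since <x_k> = a^2 X^k, the argument of
    Ustar is r^2, and (2) is (1) followed by division by m > 0.

    For (3), only two facts on the scale function are needed: it does not
    vanish, and a' = g a for a differentiable function g.  Here
    g(t) = (a1/a0) / (1 + c t) with c = n (1 + sigma) a1 / (2 a0), including in
    the exponential case sigma = -1, where c = 0.  Then
      H = (a^2)'/a^2 = 2 g,  A = - g^2 - g',  a'' = (g' + g^2) a,
    so A cancels the term a'' X of (a X)'', which leaves
      Y'' + A Y = a (X'' + H X')                        ([Dt2_rescaled]).
    As |Y|^2 = a^2 |X|^2 = r^2, the equation for Y is the one for X multiplied
    by a <> 0.

    Time derivatives are relative to the time interval I, hence one-sided at 0;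
    they are well defined because I has no isolated point
    ([time_interval_limit_point]). *)

(** * Derivatives relative to a set of times *)

Section RelativeDerivative.
Variables (R : realType) (I : set R).
Implicit Types (f g : R -> R) (t l : R).

(** [f] has derivative [l] at [t] relative to [I].  Unlike an equation on [Dt],
    this asserts that the limit exists. *)
Definition is_Dt f t l : Prop := Dquot f t s @[s --> within I t^'] --> l.

Lemma near_within_dnbhs t : \forall s \near within I t^', I s /\ s != t.
Proof.
rewrite near_withinE; near=> s => Is; split=> //.
by near: s; exact: nbhs_dnbhs_neq.
Unshelve. all: by end_near. Qed.

Lemma eq_is_Dt f g t l : I t -> {in I, f =1 g} -> is_Dt f t l -> is_Dt g t l.
Proof.
move=> It fg; apply: cvg_trans; apply: near_eq_cvg.
near=> s; have [Is _] : I s /\ s != t by near: s; exact: near_within_dnbhs.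
by rewrite /Dquot !fg// inE.
Unshelve. all: by end_near. Qed.

Lemma is_Dt_continuous f t l : is_Dt f t l -> f s @[s --> within I t^'] --> f t.
Proof.
move=> fl.
have st : (s - t) @[s --> within I t^'] --> t - t.
  apply: cvgB; last exact: cvg_cst.
  by have := @nbhs_dnbhs _ t; apply: cvg_trans; exact: cvg_within.
have: f t + Dquot f t s * (s - t) @[s --> within I t^'] --> f t + l * (t - t).
  by apply: cvgD; [exact: cvg_cst|exact: cvgM].
rewrite subrr mulr0 addr0; apply: cvg_trans; apply: near_eq_cvg.
near=> s; have [_ ts] : I s /\ s != t by near: s; exact: near_within_dnbhs.
by rewrite /Dquot divfK ?subr_eq0// addrC subrK.
Unshelve. all: by end_near. Qed.

Lemma is_DtM f g t l k : is_Dt f t l -> is_Dt g t k ->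
  is_Dt (fun s => f s * g s) t (l * g t + f t * k).
Proof.
move=> fl gk.
have: Dquot f t s * g s + f t * Dquot g t s @[s --> within I t^']
    --> l * g t + f t * k.
  apply: cvgD; last by apply: cvgM => //; exact: cvg_cst.
  by apply: cvgM => //; exact: is_Dt_continuous gk.
by apply: cvg_trans; apply: near_eq_cvg; near=> s; rewrite /Dquot; ring.
Unshelve. all: by end_near. Qed.

Lemma is_DtD f g t l k : is_Dt f t l -> is_Dt g t k ->
  is_Dt (fun s => f s + g s) t (l + k).
Proof.
move=> fl gk.
have: Dquot f t s + Dquot g t s @[s --> within I t^'] --> l + k by exact: cvgD.
by apply: cvg_trans; apply: near_eq_cvg; near=> s; rewrite /Dquot; ring.
Unshelve. all: by end_near. Qed.

Lemma is_DtZ c f t l : is_Dt f t l -> is_Dt (fun s => c * f s) t (c * l).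
Proof.
move=> fl.
have: c * Dquot f t s @[s --> within I t^'] --> c * l.
  by apply: cvgM => //; exact: cvg_cst.
by apply: cvg_trans; apply: near_eq_cvg; near=> s; rewrite /Dquot; ring.
Unshelve. all: by end_near. Qed.

Lemma is_derive_is_Dt f t l : is_derive t 1 f l -> is_Dt f t l.
Proof.
case=> df <-.
have st : (s - t) @[s --> t^'] --> (0 : R)^'.
  move=> A; rewrite /= !nbhs_simpl /= => -[e /= e0 eA]; exists e => //= s.
  rewrite /ball_/= => ts st; apply: eA => /=; rewrite ?subr_eq0//.
  by rewrite /ball_/= sub0r normrN distrC.
have : Dquot f t s @[s --> t^'] --> 'D_1 f t.
  have := cvg_comp _ _ st df; apply: cvg_trans; apply: near_eq_cvg; near=> s => /=.
  by rewrite /Dquot /= scaler1 subrK mulrC.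
by apply: cvg_trans; apply: cvg_app; exact: cvg_within.
Unshelve. all: by end_near. Qed.

(* Limits within I at t are unique only if t is not isolated in I. *)
Hypothesis limit_point : forall t, I t -> ProperFilter (within I t^').

Lemma is_Dt_Dt f t l : I t -> is_Dt f t l -> Dt I f t = l.
Proof. by move=> It fl; have := limit_point It => ?; exact: cvg_lim. Qed.

(** Rescaling of functions by a factor [a] whose logarithmic derivative is [g]. *)
Section Rescaling.
Variables a g k : R -> R.
Hypothesis a_neq0 : forall t, I t -> a t != 0.
Hypothesis a_deriv : forall t, I t -> is_Dt a t (g t * a t).
Hypothesis g_deriv : forall t, I t -> is_Dt g t (k t).

Let H t := Dt I (fun s => a s ^+ 2) t / a t ^+ 2.

Lemma Dt_sqr_ratioE t : I t -> H t = 2 * g t.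
Proof.
move=> It; rewrite /H.
have := is_DtM (a_deriv It) (a_deriv It) => /(is_Dt_Dt It) ->.
by field; exact: a_neq0.
Qed.

Lemma Dt_Dt_sqr_ratio t : I t -> Dt I H t = 2 * k t.
Proof.
move=> It; apply: is_Dt_Dt => //.
apply: (@eq_is_Dt (fun s => 2 * g s)) => // [s|].
  by rewrite inE => Is; rewrite Dt_sqr_ratioE.
exact: is_DtZ (g_deriv It).
Qed.

(** The first-order term of the equation for [X] is absorbed into a zeroth-order
    term of the equation for [a X]. *)
Lemma Dt2_rescaled (X : R -> R) t : twice_t_derivable I X -> I t ->
  Dt I (Dt I (fun s => a s * X s)) t
  + (- (1 / 4) * H t ^+ 2 - 1 / 2 * Dt I H t) * (a t * X t)
  = a t * (Dt I (Dt I X) t + H t * Dt I X t).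
Proof.
move=> [dX ddX] It.
have DY s : I s -> g s * a s * X s + a s * Dt I X s = Dt I (fun s => a s * X s) s.
  by move=> Is; rewrite (is_Dt_Dt Is (is_DtM (a_deriv Is) (dX _ Is))).
have -> : Dt I (Dt I (fun s => a s * X s)) t
    = (k t * a t + g t * (g t * a t)) * X t + g t * a t * Dt I X t
      + (g t * a t * Dt I X t + a t * Dt I (Dt I X) t).
  apply: is_Dt_Dt => //.
  apply: (eq_is_Dt It (fun s Is => DY s (set_mem Is))).
  apply: is_DtD; first apply: is_DtM (dX _ It).
    exact: is_DtM (g_deriv It) (a_deriv It).
  exact: is_DtM (a_deriv It) (ddX _ It).
by rewrite Dt_Dt_sqr_ratio// Dt_sqr_ratioE//; field.
Qed.

End Rescaling.

End RelativeDerivative.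

(** * The scale function *)

Section ScaleFunctionTheory.
Variables (R : realType) (n : nat) (a0 a1 sigma : R).
Hypotheses (n_ge1 : (1 <= n)%N) (a0_gt0 : 0 < a0).

Let I := time_interval n a0 a1 sigma.
Let a := scale n a0 a1 sigma.

(** For [sigma <> -1] the scale function is [a0] times a power of [1 + c t], where
    [c] is this slope; for [sigma = -1] the slope is 0. *)
Definition base_slope : R := n%:R * (1 + sigma) * a1 / (2 * a0).
Let c := base_slope.

Lemma base_slopeE t : n%:R * (1 + sigma) * a1 * t / (2 * a0) = c * t.
Proof. by rewrite /c /base_slope; ring. Qed.

(** The time interval consists of the times [t >= 0] before the affine function
    [1 + c t] vanishes, whichever case defines [T1]. *)
Lemma time_intervalP t : I t <-> 0 <= t /\ 0 < 1 + c * t.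
Proof.
have n_gt0 : 0 < n%:R :> R by rewrite ltr0n.
rewrite /I /time_interval /= /T1 /T0; case: ifPn => [neg|].
  have c_lt0 : n%:R * (1 + sigma) * a1 < 0 by rewrite -mulrA pmulr_rlt0.
  rewrite lte_fin ltr_ndivlMr//.
  have -> : 1 + c * t = (2 * a0 + t * (n%:R * (1 + sigma) * a1)) / (2 * a0).
    by rewrite /c /base_slope; field; rewrite gt_eqF.
  by rewrite ltr_pdivlMr ?mul0r ?mulr_gt0// -(ltrD2l (2 * a0)) subrr.
rewrite -leNgt => pos; split=> -[t0 _]; split=> //; last by rewrite ltry.
rewrite ltr_pwDl// mulr_ge0//; apply: divr_ge0; last by rewrite ltW ?mulr_gt0.
by rewrite -mulrA mulr_ge0// ltW.
Qed.

Lemma time_interval_limit_point t : I t -> ProperFilter (within I t^').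
Proof.
move=> /time_intervalP[t0 ct].
apply: Build_ProperFilter_ex => A.
rewrite /within/= => -[e /= e0 eA].
have c1 : 0 < 1 + `|c| by rewrite ltr_pwDl.
(* t + d is in the ball of radius e and 1 + c (t + d) > 0, even for c < 0. *)
pose d := Num.min (e / 2) ((1 + c * t) / (2 * (1 + `|c|))).
have d0 : 0 < d by rewrite lt_min !divr_gt0// mulr_gt0.
exists (t + d); apply: eA => /=.
- rewrite /ball_/= opprD addNKr normrN gtr0_norm// gt_min.
  by apply/orP; left; lra.
- by rewrite gt_eqF// ltrDl.
- apply/time_intervalP; split; first by rewrite addr_ge0// ltW.
  have : d * (1 + `|c|) <= (1 + c * t) / 2.
    rewrite -ler_pdivlMr// /d ge_min; apply/orP; right.
    by rewrite invfM mulrA.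
  have := ler_norm (- c); rewrite normrN => h1 h2.
  nra.
Qed.

Let is_derive_affine (t : R) : is_derive t 1 (fun s : R => 1 + c * s) c.
Proof.
by apply: is_derive_eq; rewrite add0r mul1r /GRing.scale/= mulr1.
Qed.

(** The logarithmic derivative [a'/a] of the scale function; in the exponential
    case [c = 0] and it is constant. *)
Definition log_rate t : R := a1 / a0 * (1 + c * t)^-1.

Lemma log_rate_deriv t : I t ->
  is_Dt I log_rate t (a1 / a0 * (- c * (1 + c * t) ^- 2)).
Proof.
move=> /time_intervalP[_ ct].
apply: is_DtZ; apply: is_derive_is_Dt.
have d1 := is_derive_affine t.
have d2 := is_deriveV (f := fun s => 1 + c * s) (lt0r_neq0 ct) d1.
by apply: is_derive_eq; rewrite /GRing.scale/=; ring.
Qed.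

(** The power law and the exponential law both have the form [a0 * expR phi] with
    [phi' = log_rate], which treats them at once. *)
Lemma scale_expR : exists phi : R -> R,
  (forall t, I t -> a t = a0 * expR (phi t)) /\
  (forall t, I t -> is_derive t 1 phi (log_rate t)).
Proof.
have [s1|s1] := eqVneq sigma (-1).
  exists (fun t => a1 / a0 * t); split=> t It.
    by rewrite /a /scale s1 eqxx; congr (_ * expR _); ring.
  rewrite /log_rate /c /base_slope s1 subrr mulr0 !mul0r addr0 invr1 mulr1.
  by apply: is_derive_eq; rewrite /GRing.scale/= mulr1.
exists (fun t => 2 / (n%:R * (1 + sigma)) * ln (1 + c * t)).
have n0 : n%:R != 0 :> R by rewrite pnatr_eq0 -lt0n.
have s2 : 1 + sigma != 0 by rewrite addrC addr_eq0.
split=> t /time_intervalP[_ ct].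
  by rewrite /a /scale (negbTE s1) base_slopeE /powR gt_eqF.
have d1 := is_derive_affine t.
have d2 := is_derive1_ln ct.
have d3 := is_derive1_comp (g := fun s => 1 + c * s) d2 d1.
apply: is_derive_eq; rewrite /log_rate /GRing.scale/=.
set q := (1 + c * t)^-1; rewrite /c /base_slope.
by field; rewrite s2 n0 gt_eqF.
Qed.

Lemma scale_neq0 t : I t -> a t != 0.
Proof.
move=> It; have [phi [-> // _]] := scale_expR.
by rewrite gt_eqF// mulr_gt0 ?expR_gt0.
Qed.

Lemma scale_deriv t : I t -> is_Dt I a t (log_rate t * a t).
Proof.
move=> It; have [phi [aE dphi]] := scale_expR.
apply: (eq_is_Dt It (f := fun s => a0 * expR (phi s))) => [s|].
  by rewrite inE => /aE.
rewrite aE// mulrCA; apply: is_DtZ; apply: is_derive_is_Dt.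
by have := is_derive1_comp (is_derive_expR (phi t)) (dphi t It); rewrite mulrC.
Qed.

End ScaleFunctionTheory.

(** * Expectation values and the potential *)

Section Expectations.
Variables (R : realType) (n : nat).
Implicit Types (psi : 'rV[R]_n -> R[i]) (h : 'rV[R]_n -> R).

Lemma expectZ psi h k : expect_finite psi h ->
  expect psi (fun x => k * h x) = k * expect psi h.
Proof.
move=> [hfin _]; rewrite /expect /cintegral/= -RintegralZl//.
congr (Rintegral _ _ _); apply/funext => x; rewrite /expect_density.
by case: (psi _) => p q /=; ring.
Qed.

Lemma partial_low_potential (m : R) Ustar (a : R) psi (j : 'I_n) x :
  partial_low j (potential m Ustar a psi) x
  = m * Ustar (\sum_(k < n) expect psi (coord_up k) * expect psi (coord_low a k))
    * a ^+ 2 * x 0 j.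
Proof.
(* The difference quotient of a quadratic form along e_j is affine in h. *)
rewrite /partial_low /derive; set K := \sum_(k < n) _.
apply: cvg_lim => //.
have : m * Ustar K * a ^+ 2 * (x 0 j + h / 2) @[h --> (0 : R)^']
    --> m * Ustar K * a ^+ 2 * (x 0 j + 0 / 2).
  have h0 : h @[h --> (0 : R)^'] --> (0 : R) by exact: nbhs_dnbhs.
  apply: cvgM; first exact: cvg_cst.
  apply: cvgD; first exact: cvg_cst.
  by apply: cvgM => //; exact: cvg_cst.
rewrite mul0r addr0; apply: cvg_trans; apply: near_eq_cvg.
near=> h; have h0 : h != 0 by near: h; exact: nbhs_dnbhs_neq.
rewrite /potential -/K /= -mulrBr -sumrB (bigD1 j)//= big1 => [|k kj].
  rewrite /coord_up /coord_low !mxE !eqxx /GRing.scale/=.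
  by field.
by rewrite /coord_up /coord_low !mxE (negbTE kj) andbF mulr0 add0r subrr.
Unshelve. all: by end_near. Qed.

Lemma expect_partial_up_potential (m : R) Ustar (a : R) psi (j : 'I_n) :
  a != 0 -> (forall k, expect_finite psi (coord_up k)) ->
  expect psi (partial_up a j (potential m Ustar a psi))
  = m * Ustar (\sum_(k < n) expect psi (coord_up k) * expect psi (coord_low a k))
    * expect psi (coord_up j).
Proof.
move=> a0 fin; set K := \sum_(k < n) _.
rewrite -expectZ//; congr expect; apply/funext => x.
by rewrite /partial_up partial_low_potential -/K /coord_up; field.
Qed.

End Expectations.

(** * The rescaled equations of motion *)

Theorem lemma3 (R : realType) (n : nat) (m a0 a1 sigma : R) (Ustar : R -> R)
    (u : R -> 'rV[R]_n -> R[i])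
    (n_ge1 : (1 <= n)%N) (m_gt0 : 0 < m) (a0_gt0 : 0 < a0) :
  let a := scale n a0 a1 sigma in
  let I := time_interval n a0 a1 sigma in
  let D := Dt I in
  let U := fun t => potential m Ustar (a t) (u t) in
  let X := fun (j : 'I_n) t => expect (u t) (coord_up j) in
  let Xlow := fun (j : 'I_n) t => expect (u t) (coord_low (a t) j) in
  let dU := fun (j : 'I_n) t => expect (u t) (partial_up (a t) j (U t)) in
  let r := fun t => Num.sqrt (\sum_(j < n) X j t * Xlow j t) in
  let Y := fun (j : 'I_n) t => a t * X j t in
  let normY := fun t => Num.sqrt (\sum_(j < n) Y j t ^+ 2) in
  let a2 := fun t => a t ^+ 2 in
  let H := fun t => D a2 t / a2 t in
  let A := fun t => - (1 / 4) * H t ^+ 2 - 1 / 2 * D H t in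
  (forall t, I t -> forall j, expect_finite (u t) (coord_up j)) ->
  (forall t, I t -> forall j, dU j t = m * Ustar (r t ^+ 2) * X j t)
  /\
  ((forall j, twice_t_derivable I (X j)) ->
    (forall t, I t -> forall j,
      m * D (D (X j)) t + m * H t * D (X j) t + dU j t = 0
      <->
      D (D (X j)) t + H t * D (X j) t + Ustar (r t ^+ 2) * X j t = 0)
    /\
    (forall t, I t -> forall j,
      D (D (X j)) t + H t * D (X j) t + Ustar (r t ^+ 2) * X j t = 0
      <->
      D (D (Y j)) t + A t * Y j t + Ustar (normY t ^+ 2) * Y j t = 0)).
Proof.
move=> a I D U X Xlow dU r Y normY a2 H A fin.
have a_neq0 := scale_neq0 (a1 := a1) (sigma := sigma) n_ge1 a0_gt0.
have XlowE t j : I t -> Xlow j t = a t ^+ 2 * X j t.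
  by move=> It; exact/expectZ/fin.
have XXlowE t j : I t -> X j t * Xlow j t = Y j t ^+ 2.
  by move=> It; rewrite XlowE// /Y; ring.
have r2E t : I t -> r t ^+ 2 = \sum_(j < n) X j t * Xlow j t.
  move=> It; rewrite sqr_sqrtr// sumr_ge0// => j _.
  by rewrite XXlowE// sqr_ge0.
have normY_r t : I t -> normY t = r t.
  by move=> It; congr Num.sqrt; apply: eq_bigr => j _; rewrite XXlowE.
have dUE t j : I t -> dU j t = m * Ustar (r t ^+ 2) * X j t.
  move=> It; rewrite r2E//.
  by apply: expect_partial_up_potential; [exact: a_neq0|exact: fin].
split=> [t It j|dX]; first exact: dUE.
split=> t It j.
  have -> : m * D (D (X j)) t + m * H t * D (X j) t + dU j t
    = m * (D (D (X j)) t + H t * D (X j) t + Ustar (r t ^+ 2) * X j t).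
    by rewrite dUE//; ring.
  by split=> [/eqP|->]; rewrite ?mulr0// mulf_eq0 gt_eqF//= => /eqP.
have lim_pt := time_interval_limit_point (a1 := a1) (sigma := sigma) n_ge1 a0_gt0.
have a_deriv := scale_deriv (a1 := a1) (sigma := sigma) n_ge1 a0_gt0.
have g_deriv := log_rate_deriv (a1 := a1) (sigma := sigma) n_ge1 a0_gt0.
have Y2E : D (D (Y j)) t + A t * Y j t = a t * (D (D (X j)) t + H t * D (X j) t).
  exact: Dt2_rescaled lim_pt _ _ _ a_neq0 a_deriv g_deriv _ _ (dX j) It.
have -> : D (D (Y j)) t + A t * Y j t + Ustar (normY t ^+ 2) * Y j t
    = a t * (D (D (X j)) t + H t * D (X j) t + Ustar (r t ^+ 2) * X j t).
  by rewrite Y2E normY_r// /Y; ring.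
by split=> [->|/eqP]; rewrite ?mulr0// mulf_eq0 (negbTE (a_neq0 _ It))/= => /eqP.
Qed.
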